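(* Let $(\mathcal{C},\phi,\Delta)$ be a cyclic categorical Garside structure with Garside groupoid $\mathcal{G}$, and let $\gamma$ be a periodic loop in $\mathcal{G}$, i.e. an endomorphism $\gamma$ of an object $x$ in $\mathcal{G}$ such that $\gamma^q=\Delta^p$ for some positive integers $p,q$. Then there exist a Garside groupoid $\mathcal{G}_q$ and an equivalence of categories $\Theta_q:\mathcal{G}\to\mathcal{G}_q$ such that $\Theta_q(\gamma)$ is conjugate to a Garside element. That is, there exist a categorical Garside structure $(\mathcal{C}',\phi',\Delta')$ with Garside groupoid $\mathcal{G}_q$, an equivalence of categories $\Theta_q:\mathcal{G}\to\mathcal{G}_q$, an object $y$ of $\mathcal{C}'$ and a morphism $c$ of $\mathcal{G}_q$ such that $\Theta_q(\gamma)\,c=c\,\Delta'_y$.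
   Context: Conventions. Morphisms compose like paths: $x\xrightarrow{f}y\xrightarrow{g}z$ has composite $fg$. The image of an object or morphism under an automorphism $\phi$ is written $x^\phi$, $f^\phi$. In a category $\mathcal{C}$, $\mathcal{C}_{x\to}$ (resp. $\mathcal{C}_{\to x}$) is the set of morphisms with source (resp. target) $x$; $f\le g$ on $\mathcal{C}_{x\to}$ means $g=fh$ for some $h$; $g\ge h$ on $\mathcal{C}_{\to x}$ means $g=fh$ for some $f$. An atom is a non-identity morphism that is not a product of two non-identity morphisms. A categorical Garside structure is a triple $(\mathcal{C},\phi,\Delta)$ where $\mathcal{C}$ is a small category, $\phi$ is an automorphism of $\mathcal{C}$ and $\Delta$ is a natural transformation from the identity functor to $\phi$ (so $\Delta_x:x\to x^\phi$ and $f\Delta_y=\Delta_xf^\phi$ for $f:x\to y$), such that: $\mathcal{C}$ is homogeneous (there is a function $l$ from morphisms to $\mathbb{Z}_{\ge0}$ with $l(fg)=l(f)+l(g)$ and $l(f)=0$ iff $f$ is an identity); $\mathcal{C}$ is cancellative ($afb=agb$ implies $f=g$); every atom is simple, where $f:x\to y$ is simple if there is $\overline f:y\to x^\phi$ with $f\overline f=\Delta_x$; for every object $x$, $(\mathcal{C}_{x\to},\le)$ and $(\mathcal{C}_{\to x},\ge)$ are lattices. It is cyclic if $\phi^k=1$ for some $k\ge1$. The morphisms $\Delta_x$ are called Garside elements. The Garside groupoid of the structure is the groupoid obtained from $\mathcal{C}$ by formally inverting all morphisms ($\mathcal{C}$ embeds in it, and $\phi,\Delta$ extend to it). $\Delta^p$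 with source $x$ denotes the product $\Delta_x\Delta_{x^\phi}\cdots\Delta_{x^{\phi^{p-1}}}$ of $p$ successive Garside elements; in $\gamma^q=\Delta^p$ both sides have source $x$. *)

(* Defs.v *)
From HB Require Import structures.
From Stdlib Require Relation_Definitions.
From mathcomp Require Import all_boot.
From mathcomp Require Import boolp.

Set Implicit Arguments.
Unset Strict Implicit.
Unset Printing Implicit Defensive.

Local Open Scope quotient_scope.

(* Composition is written in the order of paths: for [f : hom x y] and
   [g : hom y z], the composite "f then g" is [f \; g : hom x z]. *)
Record category := Category {
  ob :> Type;
  hom : ob -> ob -> Type;
  idm : forall x, hom x x;
  compm : forall x y z, hom x y -> hom y z -> hom x z;
  comp1m : forall x y (f : hom x y), compm (idm x) f = f;
  compm1 : forall x y (f : hom x y), compm f (idm y) = f;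
  compmA : forall x y z t (f : hom x y) (g : hom y z) (h : hom z t),
    compm f (compm g h) = compm (compm f g) h }.

Arguments idm {c} x.

Declare Scope cat_scope.
Delimit Scope cat_scope with cat.
Local Open Scope cat_scope.
Notation "f \; g" := (compm f g) : cat_scope.

(* A morphism together with its source and target. Equality in [arrow C] is
   equality of morphisms whose endpoints are not syntactically the same;
   it entails equality of the endpoints. *)
Record arrow (C : category) := Arrow {
  source : C;
  target : C;
  mor : hom source target }.

Arguments Arrow {C source target} mor.

Record functor (C D : category) := Functor {
  fob :> C -> D;
  fmap : forall x y, hom x y -> hom (fob x) (fob y);
  fmap1 : forall x, fmap (idm x) = idm (fob x);
  fmapM : forall x y z (f : hom x y) (g : hom y z),
    fmap (f \; g) = fmap f \; fmap g }.

Definition functor_id (C : category) : functor C C :=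
  @Functor C C id (fun _ _ f => f) (fun _ => erefl) (fun _ _ _ _ _ => erefl).

(* First F, then G. *)
Definition functor_comp (C D E : category) (F : functor C D) (G : functor D E) :
  functor C E.
Proof.
refine (@Functor C E (fun x => G (F x)) (fun x y f => fmap G (fmap F f)) _ _).
- by move=> x; rewrite !fmap1.
- by move=> x y z f g; rewrite !fmapM.
Defined.

Fixpoint functor_pow (C : category) (F : functor C C) (n : nat) : functor C C :=
  if n is m.+1 then functor_comp F (functor_pow F m) else functor_id C.

(* Strict equality of functors; on objects it follows by taking [f] to be
   identities. *)
Definition functor_eq (C D : category) (F G : functor C D) : Prop :=
  forall (x y : C) (f : hom x y), Arrow (fmap F f) = Arrow (fmap G f).

Definition is_automorphism (C : category) (F : functor C C) : Prop :=
  exists G : functor C C,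
    functor_eq (functor_comp F G) (functor_id C) /\
    functor_eq (functor_comp G F) (functor_id C).

Definition is_iso (C : category) (x y : C) (f : hom x y) : Prop :=
  exists g : hom y x, f \; g = idm x /\ g \; f = idm y.

Lemma is_iso_comp (C : category) (x y z : C) (f : hom x y) (g : hom y z) :
  is_iso f -> is_iso g -> is_iso (f \; g).
Proof.
move=> [f' [ff' f'f]] [g' [gg' g'g]]; exists (g' \; f'); split.
- by rewrite compmA -(compmA f) gg' compm1.
- by rewrite compmA -(compmA g') f'f compm1.
Qed.

Definition is_groupoid (C : category) : Prop :=
  forall (x y : C) (f : hom x y), is_iso f.

Definition naturally_isomorphic (C D : category) (F G : functor C D) : Prop :=
  exists eta : forall x : C, hom (F x) (G x),
    (forall x, is_iso (eta x)) /\
    (forall (x y : C) (f : hom x y), fmap F f \; eta y = eta x \; fmap G f).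

Definition is_equivalence (C D : category) (F : functor C D) : Prop :=
  exists G : functor D C,
    naturally_isomorphic (functor_comp F G) (functor_id C) /\
    naturally_isomorphic (functor_comp G F) (functor_id D).

Fixpoint loop_pow (C : category) (x : C) (f : hom x x) (n : nat) : hom x x :=
  if n is m.+1 then f \; loop_pow f m else idm x.

Section GarsideAxioms.
Variable C : category.

Definition is_identity (x y : C) (f : hom x y) : Prop := Arrow f = Arrow (idm x).

Definition is_atom (x y : C) (f : hom x y) : Prop :=
  ~ is_identity f /\
  forall (z : C) (g : hom x z) (h : hom z y),
    f = g \; h -> is_identity g \/ is_identity h.

Definition homogeneous : Prop :=
  exists l : forall x y : C, hom x y -> nat,
    (forall (x y z : C) (f : hom x y) (g : hom y z), l _ _ (f \; g) = l _ _ f + l _ _ g) /\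
    (forall (x y : C) (f : hom x y), l _ _ f = 0 <-> is_identity f).

Definition cancellative : Prop :=
  forall (x y z t : C) (a : hom x y) (f g : hom y z) (b : hom z t),
    (a \; f) \; b = (a \; g) \; b -> f = g.

Definition mor_from (x : C) : Type := {y : C & hom x y}.
Definition mor_to (x : C) : Type := {y : C & hom y x}.

Definition le_from (x : C) (f g : mor_from x) : Prop :=
  exists h : hom (tag f) (tag g), tagged g = tagged f \; h.

Definition ge_to (x : C) (g h : mor_to x) : Prop :=
  exists f : hom (tag g) (tag h), tagged g = f \; tagged h.

Definition is_lattice (T : Type) (le : T -> T -> Prop) : Prop :=
  Relation_Definitions.order T le /\
  forall a b : T,
    (exists j, [/\ le a j, le b j & forall c, le a c -> le b c -> le j c]) /\
    (exists m, [/\ le m a, le m b & forall c, le c a -> le c b -> le c m]).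

Variables (phi : functor C C) (Delta : forall x : C, hom x (phi x)).

Definition is_simple (x y : C) (f : hom x y) : Prop :=
  exists fbar : hom y (phi x), f \; fbar = Delta x.

End GarsideAxioms.

Record garside_structure := GarsideStructure {
  gcat :> category;
  phi : functor gcat gcat;
  Delta : forall x : gcat, hom x (phi x);
  phi_auto : is_automorphism phi;
  Delta_natural : forall (x y : gcat) (f : hom x y),
    f \; Delta y = Delta x \; fmap phi f;
  garside_homogeneous : homogeneous gcat;
  garside_cancellative : cancellative gcat;
  atom_simple : forall (x y : gcat) (f : hom x y),
    is_atom f -> is_simple Delta f;
  lattice_from : forall x : gcat, is_lattice (@le_from gcat x);
  lattice_to : forall x : gcat, is_lattice (@ge_to gcat x) }.

Definition is_cyclic (S : garside_structure) : Prop :=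
  exists2 k : nat, 1 <= k & functor_eq (functor_pow (phi S) k) (functor_id S).

Fixpoint Delta_pow (S : garside_structure) (p : nat) :
    forall x : S, hom x (functor_pow (phi S) p x) :=
  if p is p'.+1 then fun x => Delta x \; Delta_pow p' (phi S x)
  else fun x => idm x.

(* The groupoid obtained from C by formally inverting all morphisms: its
   objects are those of C; its morphisms are zigzags of morphisms of C,
   modulo the congruence making [zz_fwd] functorial and [zz_bwd f] inverse
   to [zz_fwd f]. *)

Section Localization.
Variable C : category.

Inductive zigzag : C -> C -> Type :=
| zz_nil x : zigzag x x
| zz_fwd x y z (f : hom x y) (w : zigzag y z) : zigzag x z
| zz_bwd x y z (f : hom y x) (w : zigzag y z) : zigzag x z.

Inductive zz_eq : forall x y, zigzag x y -> zigzag x y -> Prop :=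
| zz_refl x y (u : zigzag x y) : zz_eq u u
| zz_sym x y (u v : zigzag x y) : zz_eq u v -> zz_eq v u
| zz_trans x y (u v w : zigzag x y) : zz_eq u v -> zz_eq v w -> zz_eq u w
| zz_fwd_congr x y z (f : hom x y) (u v : zigzag y z) :
    zz_eq u v -> zz_eq (zz_fwd f u) (zz_fwd f v)
| zz_bwd_congr x y z (f : hom y x) (u v : zigzag y z) :
    zz_eq u v -> zz_eq (zz_bwd f u) (zz_bwd f v)
| zz_fwd1 x y (u : zigzag x y) : zz_eq (zz_fwd (idm x) u) u
| zz_fwdM x y z t (f : hom x y) (g : hom y z) (u : zigzag z t) :
    zz_eq (zz_fwd (f \; g) u) (zz_fwd f (zz_fwd g u))
| zz_fwdK x y z (f : hom x y) (u : zigzag x z) :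
    zz_eq (zz_fwd f (zz_bwd f u)) u
| zz_bwdK x y z (f : hom y x) (u : zigzag x z) :
    zz_eq (zz_bwd f (zz_fwd f u)) u.

HB.instance Definition _ (x y : C) := gen_eqMixin (zigzag x y).
HB.instance Definition _ (x y : C) := gen_choiceMixin (zigzag x y).

Definition zz_rel (x y : C) : rel (zigzag x y) := fun u v => `[< zz_eq u v >].

Lemma zz_rel_refl x y : reflexive (@zz_rel x y).
Proof. by move=> u; apply/asboolP; apply: zz_refl. Qed.

Lemma zz_rel_sym x y : symmetric (@zz_rel x y).
Proof. by move=> u v; apply/asboolP/asboolP; apply: zz_sym. Qed.

Lemma zz_rel_trans x y : transitive (@zz_rel x y).
Proof.
by move=> v u w /asboolP uv /asboolP vw; apply/asboolP; apply: zz_trans uv vw.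
Qed.

Canonical zz_equiv (x y : C) :=
  EquivRel (@zz_rel x y) (@zz_rel_refl x y) (@zz_rel_sym x y) (@zz_rel_trans x y).

Definition loc_hom (x y : C) : Type := {eq_quot (zz_equiv x y)}.

Definition loc_class (x y : C) (u : zigzag x y) : loc_hom x y :=
  \pi_({eq_quot (zz_equiv x y)}) u.

Definition loc_repr (x y : C) (a : loc_hom x y) : zigzag x y :=
  repr (a : {eq_quot (zz_equiv x y)}).

Lemma loc_classP x y (u v : zigzag x y) : loc_class u = loc_class v <-> zz_eq u v.
Proof.
rewrite /loc_class; split=> [/eqmodP /asboolP //|uv].
by apply/eqmodP; apply/asboolP.
Qed.

Lemma loc_reprK x y (a : loc_hom x y) : loc_class (loc_repr a) = a.
Proof. exact: reprK. Qed.

Lemma loc_repr_class x y (u : zigzag x y) : zz_eq (loc_repr (loc_class u)) u.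
Proof. by apply/loc_classP; rewrite loc_reprK. Qed.

Fixpoint zz_cat (x y z : C) (u : zigzag x y) : zigzag y z -> zigzag x z :=
  match u in zigzag x y return zigzag y z -> zigzag x z with
  | zz_nil _ => fun v => v
  | zz_fwd _ _ _ f w => fun v => zz_fwd f (zz_cat w v)
  | zz_bwd _ _ _ f w => fun v => zz_bwd f (zz_cat w v)
  end.

Lemma zz_cat0 x y (u : zigzag x y) : zz_cat u (zz_nil y) = u.
Proof. by elim: u => //= {}x {}y z f w ->. Qed.

Lemma zz_catA x y z t (u : zigzag x y) (v : zigzag y z) (w : zigzag z t) :
  zz_cat u (zz_cat v w) = zz_cat (zz_cat u v) w.
Proof. by elim: u v => //= {}x {}y z' f u IH v; rewrite IH. Qed.

Lemma zz_cat_congr x y z (u u' : zigzag x y) (v v' : zigzag y z) :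
  zz_eq u u' -> zz_eq v v' -> zz_eq (zz_cat u v) (zz_cat u' v').
Proof.
move=> uu' vv'; apply: (@zz_trans _ _ _ (zz_cat u' v)).
  elim: uu' v {v' vv'} => /= {x y u u'}.
  - by move=> x y u v; apply: zz_refl.
  - by move=> x y u u' _ IH v; apply: zz_sym.
  - by move=> x y u u' u'' _ IH1 _ IH2 v; apply: zz_trans (IH1 v) (IH2 v).
  - by move=> x y t f u u' _ IH v; apply: zz_fwd_congr.
  - by move=> x y t f u u' _ IH v; apply: zz_bwd_congr.
  - by move=> x y u v; apply: zz_fwd1.
  - by move=> x y t s f g u v; apply: zz_fwdM.
  - by move=> x y t f u v; apply: zz_fwdK.
  - by move=> x y t f u v; apply: zz_bwdK.
elim: u' v v' vv' {u uu'} => //= {}x {}y t f w IH v v' vv'.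
- by apply: zz_fwd_congr; apply: IH.
- by apply: zz_bwd_congr; apply: IH.
Qed.

Definition loc_comp (x y z : C) (a : loc_hom x y) (b : loc_hom y z) : loc_hom x z :=
  loc_class (zz_cat (loc_repr a) (loc_repr b)).

Lemma loc_compE x y z (u : zigzag x y) (v : zigzag y z) :
  loc_comp (loc_class u) (loc_class v) = loc_class (zz_cat u v).
Proof. by apply/loc_classP; apply: zz_cat_congr; apply: loc_repr_class. Qed.

Lemma loc_comp1m x y (a : loc_hom x y) : loc_comp (loc_class (zz_nil x)) a = a.
Proof. by rewrite -(loc_reprK a) loc_compE. Qed.

Lemma loc_compm1 x y (a : loc_hom x y) : loc_comp a (loc_class (zz_nil y)) = a.
Proof. by rewrite -(loc_reprK a) loc_compE zz_cat0. Qed.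

Lemma loc_compA x y z t (a : loc_hom x y) (b : loc_hom y z) (c : loc_hom z t) :
  loc_comp a (loc_comp b c) = loc_comp (loc_comp a b) c.
Proof.
by rewrite -(loc_reprK a) -(loc_reprK b) -(loc_reprK c) !loc_compE zz_catA.
Qed.

Definition localization : category :=
  @Category C loc_hom (fun x => loc_class (zz_nil x)) loc_comp
    loc_comp1m loc_compm1 loc_compA.

Lemma loc_fmap1 (x : C) :
  loc_class (zz_fwd (idm x) (zz_nil x)) = idm (x : localization).
Proof. by apply/loc_classP; apply: zz_fwd1. Qed.

Lemma loc_fmapM (x y z : C) (f : hom x y) (g : hom y z) :
  loc_class (zz_fwd (f \; g) (zz_nil z)) =
  loc_comp (loc_class (zz_fwd f (zz_nil y))) (loc_class (zz_fwd g (zz_nil z))).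
Proof. by rewrite loc_compE; apply/loc_classP; apply: zz_fwdM. Qed.

Definition loc_functor : functor C localization :=
  @Functor C localization id (fun x y f => loc_class (zz_fwd f (zz_nil y)))
    loc_fmap1 loc_fmapM.

Definition loc_inv (x y : C) (f : hom x y) : @hom localization y x :=
  loc_class (zz_bwd f (zz_nil x)).

Lemma loc_fmapV (x y : C) (f : hom x y) :
  (fmap loc_functor f \; loc_inv f = idm _) /\
  (loc_inv f \; fmap loc_functor f = idm _).
Proof.
split; rewrite /= loc_compE; apply/loc_classP.
- exact: zz_fwdK.
- exact: zz_bwdK.
Qed.

Lemma loc_ind (P : forall x y : C, @hom localization x y -> Prop) :
  (forall x : C, P x x (idm (x : localization))) ->
  (forall (x y z : C) (f : @hom C x y) (a : @hom localization y z),
      P y z a -> P x z (fmap loc_functor f \; a)) ->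
  (forall (x y z : C) (f : @hom C y x) (a : @hom localization y z),
      P y z a -> P x z (loc_inv f \; a)) ->
  forall x y (a : @hom localization x y), P x y a.
Proof.
move=> P1 Pf Pb x y a; rewrite -(loc_reprK a).
elim: (loc_repr a) => {x y a} [x|x y z f w IH|x y z f w IH]; first exact: P1.
- by have := Pf _ _ _ f _ IH; rewrite /= loc_compE.
- by have := Pb _ _ _ f _ IH; rewrite /= loc_compE.
Qed.

Lemma localization_groupoid : is_groupoid localization.
Proof.
apply: loc_ind => [x|x y z f a|x y z f a].
- by exists (idm (x : localization)); rewrite comp1m.
- by apply: is_iso_comp; exists (loc_inv f); apply: loc_fmapV.
- apply: is_iso_comp; exists (fmap loc_functor f).
  by have [fV Vf] := loc_fmapV f.
Qed.

Section Universal.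
Variables (H : category) (H_groupoid : is_groupoid H) (F : functor C H).

Definition inv_in (x y : H) (f : hom x y) : hom y x := projT1 (cid (H_groupoid f)).

Lemma inv_inP (x y : H) (f : hom x y) :
  (f \; inv_in f = idm x) /\ (inv_in f \; f = idm y).
Proof. exact: (projT2 (cid (H_groupoid f))). Qed.

Fixpoint zz_eval (x y : C) (u : zigzag x y) : hom (F x) (F y) :=
  match u in zigzag x y return hom (F x) (F y) with
  | zz_nil x => idm (F x)
  | zz_fwd _ _ _ f w => fmap F f \; zz_eval w
  | zz_bwd _ _ _ f w => inv_in (fmap F f) \; zz_eval w
  end.

Lemma zz_eval_cat x y z (u : zigzag x y) (v : zigzag y z) :
  zz_eval (zz_cat u v) = zz_eval u \; zz_eval v.
Proof.
elim: u v => /= [x' v|x' y' z' f w IH v|x' y' z' f w IH v].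
- by rewrite comp1m.
- by rewrite IH compmA.
- by rewrite IH compmA.
Qed.

Lemma zz_eval_eq x y (u v : zigzag x y) : zz_eq u v -> zz_eval u = zz_eval v.
Proof.
elim=> //= {x y u v}.
- by move=> x y u v w _ -> _ ->.
- by move=> x y z f u v _ ->.
- by move=> x y z f u v _ ->.
- by move=> x y u; rewrite fmap1 comp1m.
- by move=> x y z t f g u; rewrite fmapM compmA.
- by move=> x y z f u; rewrite compmA (inv_inP _).1 comp1m.
- by move=> x y z f u; rewrite compmA (inv_inP _).2 comp1m.
Qed.

Lemma localization_universal :
  exists F' : functor localization H, functor_eq (functor_comp loc_functor F') F.
Proof.
have eval_class x y (u : zigzag x y) :
    zz_eval (loc_repr (loc_class u)) = zz_eval u.
  by apply: zz_eval_eq; apply: loc_repr_class.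
unshelve eexists.
  refine (@Functor localization H F (fun x y a => zz_eval (loc_repr a)) _ _).
  - by move=> x; rewrite eval_class.
  - move=> x y z a b; rewrite -(loc_reprK a) -(loc_reprK b) /= loc_compE.
    by rewrite !eval_class zz_eval_cat.
by move=> x y f /=; rewrite eval_class /= compm1.
Qed.

Lemma localization_unique (G G' : functor localization H) :
  functor_eq (functor_comp loc_functor G) (functor_comp loc_functor G') ->
  functor_eq G G'.
Proof.
have arr_eq (x y x' y' : H) (f : hom x y) (f' : hom x' y') :
    Arrow f = Arrow f' -> exists (ex : x = x') (ey : y = y'),
      f' = eq_rect y (hom x') (eq_rect x (fun z => hom z y) f x' ex) y' ey.
  by move=> e; pose P (a : arrow H) := exists (ex : x = source a) (ey : y = target a),
    mor a = eq_rect y (hom (source a)) (eq_rect x (fun z => hom z y) f _ ex) _ ey;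
    have : P (Arrow f') by rewrite -e; exists erefl, erefl.
have arr_comp (x y z x' y' z' : H) (f : hom x y) (g : hom y z)
    (f' : hom x' y') (g' : hom y' z') : Arrow f = Arrow f' -> Arrow g = Arrow g' ->
    Arrow (f \; g) = Arrow (f' \; g').
  move=> /arr_eq[ex [ey ->]] /arr_eq[ey' [ez ->]].
  by destruct ex, ez; rewrite (Prop_irrelevance ey' ey); destruct ey.
have arr_inv (x y x' y' : H) (f : hom x y) (f' : hom x' y')
    (g : hom y x) (g' : hom y' x') : Arrow f = Arrow f' ->
    f \; g = idm x -> g' \; f' = idm y' -> Arrow g = Arrow g'.
  move=> /arr_eq[ex [ey ->]]; destruct ex, ey => /= fg gf.
  by rewrite -[g]comp1m -gf -compmA fg compm1.
move=> GG'; apply: loc_ind => [x|x y z f a IH|x y z f a IH].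
- by have := GG' x x (idm x); rewrite /= loc_fmap1.
- by rewrite !fmapM; apply: arr_comp => //; apply: GG'.
- rewrite !fmapM; apply: arr_comp => //.
  apply: (arr_inv _ _ _ _ _ _ _ _ (GG' _ _ f)); rewrite /= -fmapM.
  + by rewrite (loc_fmapV f).1 fmap1.
  + by rewrite (loc_fmapV f).2 fmap1.
Qed.

End Universal.
End Localization.

Definition garside_groupoid (S : garside_structure) : category := localization S.

Definition to_groupoid (S : garside_structure) : functor S (garside_groupoid S) :=
  loc_functor S.

(* Main.v *)
Require Import Defs.
From mathcomp Require Import all_boot.
From mathcomp Require Import boolp.

(** Let [phi^k = 1]. The products of [k * p] successive Garside elements,
    being natural from the identity functor to [phi^(k * p) = 1], are central
    loops [delta x : x -> x]. They are still divisible by every atom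
    ([central_power]), and raising [gamma^q = Delta^p] to the power [k] gives
    [gamma^Q = delta x] with [Q = k * q]. So only this situation matters: a
    category with central Garside loops, and a root [gamma] of one of them.

    Then [delta] can be divided into [Q] parts. In the lattice of all
    morphisms of the groupoid out of a base point, on which [delta] acts by
    translation, consider the increasing sequences [(u_i)], for [i] an integer,
    such that [u_(i+Q) = u_i delta]. They form a lattice for the pointwise
    order, and the shift, which moves [u_i] to [u_(i+1)], is a [Q]-th root of
    [delta]. Modulo the loops at the base point, such a sequence is a cyclic
    factorization of [delta] into [Q] factors. These are the objects of the
    divided category. The shift is its Garside element: the only axioms that
    need an idea are the lattice property, for which the pointwise joins
    suffice ([lattice_from_joins], [lattice_to_joins]), and the simplicity of
    atoms ([divided_atom_simple]). Sending [x] to the factorization with one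
    nontrivial factor [delta x] is an equivalence after localization
    ([iota_equivalence]).

    A sequence that [gamma] shifts, namely [u_i = gamma^i v], makes [gamma] a
    Garside element. It is increasing as soon as [v <= gamma v], and the meet
    [v] of [1, gamma, ..., gamma^(Q-1)] has this property: [gamma v] is the
    meet of [gamma, ..., gamma^Q], and each of these is above [v], the last
    one because [1 <= delta = gamma^Q]. The lemma [periodic_loop_positive]
    carries this out in the category itself, after multiplication by a power
    of [delta]. This loses nothing, since every morphism of the groupoid is a
    fraction [delta^-m f] ([loc_fraction]) and the category embeds into its
    localization ([loc_faithful]). *)

Set Implicit Arguments.
Unset Strict Implicit.
Unset Printing Implicit Defensive.

Local Open Scope cat_scope.

(** * Equality of morphisms with different endpoints *)

Section Arrows.
Variable C : category.

(** Destructing the equalities [ex] and [ey] gives [f] and [f'] the same type. *)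
Lemma arrow_eqP (x y x' y' : C) (f : hom x y) (f' : hom x' y') :
  Arrow f = Arrow f' -> exists (ex : x = x') (ey : y = y'),
    f' = eq_rect y (hom x') (eq_rect x (fun z => hom z y) f x' ex) y' ey.
Proof.
move=> e; pose P (a : arrow C) := exists (ex : x = source a) (ey : y = target a),
  mor a = eq_rect y (hom (source a)) (eq_rect x (fun z => hom z y) f _ ex) _ ey.
by have : P (Arrow f') by rewrite -e; exists erefl, erefl.
Qed.

Lemma arrow_inj (x y : C) (f g : hom x y) : Arrow f = Arrow g -> f = g.
Proof.
move=> /arrow_eqP[ex [ey ->]].
by rewrite (Prop_irrelevance ex erefl) (Prop_irrelevance ey erefl).
Qed.

Lemma arrow_comp (x y z x' y' z' : C) (f : hom x y) (g : hom y z)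
    (f' : hom x' y') (g' : hom y' z') :
  Arrow f = Arrow f' -> Arrow g = Arrow g' -> Arrow (f \; g) = Arrow (f' \; g').
Proof.
move=> /arrow_eqP[ex [ey ->]] /arrow_eqP[ey' [ez ->]].
by destruct ex, ez; rewrite (Prop_irrelevance ey' ey); destruct ey.
Qed.

Lemma arrow_idm (x y : C) : x = y -> Arrow (idm x) = Arrow (idm y).
Proof. by move->. Qed.

Lemma identity_iso (x y : C) (f : hom x y) : is_identity f -> is_iso f.
Proof.
move=> /esym/arrow_eqP[ex [ey ->]]; destruct ey.
by rewrite (Prop_irrelevance ex erefl) /=; exists (idm x); rewrite comp1m.
Qed.

Lemma loop_powD (x : C) (f : hom x x) m n :
  loop_pow f (m + n) = loop_pow f m \; loop_pow f n.
Proof. by elim: m => [|m IHm] /=; rewrite ?comp1m // IHm compmA. Qed.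

Lemma loop_powM (x : C) (f : hom x x) m n :
  loop_pow f (m * n) = loop_pow (loop_pow f n) m.
Proof. by elim: m => [|m IHm] //=; rewrite mulSn loop_powD IHm. Qed.

Lemma loop_pow_comm (x y : C) (f : hom x x) (g : hom y y) (h : hom x y) n :
  h \; g = f \; h -> h \; loop_pow g n = loop_pow f n \; h.
Proof.
move=> e; elim: n => [|n IHn] /=; first by rewrite comp1m compm1.
by rewrite compmA e -compmA IHn compmA.
Qed.

End Arrows.

Lemma arrow_fmap (C D : category) (F : functor C D) (x y x' y' : C)
    (f : hom x y) (f' : hom x' y') :
  Arrow f = Arrow f' -> Arrow (fmap F f) = Arrow (fmap F f').
Proof. exact: (congr1 (fun a => Arrow (fmap F (mor a)))). Qed.

Lemma functor_ext (C D : category) (F G : functor C D) : functor_eq F G -> F = G.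
Proof.
case: F G => [F F' F1 FM] [G G' G1 GM] FG.
have eFG : F = G.
  by apply/funext => x; apply: (congr1 (@source D) (FG x x (idm x))).
case: _ / eFG in G' G1 GM FG *.
have eFG' : F' = G'.
  apply: functional_extensionality_dep => x.
  apply: functional_extensionality_dep => y.
  by apply/funext => f; apply/arrow_inj/FG.
case: _ / eFG' in G1 GM FG *.
by congr Functor; apply: Prop_irrelevance.
Qed.

(** * Lattices from joins *)

(** A common lower bound [m] of minimal rank is the meet: the join of [m] with
    another common lower bound is a common lower bound above [m], hence of no
    larger rank, hence [m] itself. *)
Lemma meet_of_joins (T : Type) (le : T -> T -> Prop) (a b c : T) (mu : T -> nat) :
    Relation_Definitions.order T le ->
    (forall d e, exists j,
      [/\ le d j, le e j & forall c, le d c -> le e c -> le j c]) ->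
    le c a -> le c b ->
    (forall d e, le d e -> le e a -> mu e <= mu d /\ (mu e = mu d -> d = e)) ->
  exists m, [/\ le m a, le m b & forall c, le c a -> le c b -> le c m].
Proof.
move=> [le_refl le_trans _] joins ca cb mu_dec.
have [n le_n] := ubnP (mu c); elim: n => // n IHn in c le_n ca cb *.
have [c_max|/existsNP[d]] := pselect (forall d, le d a -> le d b -> le d c).
  by exists c.
move=> /not_implyP[da] /not_implyP[db ndc].
have [j [cj dj jP]] := joins c d.
have ja := jP _ ca da; have jb := jP _ cb db.
apply: (IHn j) => //; have [le_mu mu_eq] := mu_dec _ _ cj ja.
rewrite -ltnS; apply: leq_trans le_n; rewrite !ltnS ltn_neqAle le_mu andbT.
by apply/eqP => /mu_eq cj'; rewrite cj' in ndc.
Qed.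

Section Cancellative.
Variables (D : category) (D_canc : cancellative D).

Lemma comp_injl (x y z : D) (a : hom x y) (f g : hom y z) : a \; f = a \; g -> f = g.
Proof. by move=> e; apply: (D_canc (a := a) (b := idm z)); rewrite e. Qed.

Lemma comp_injr (x y z : D) (f g : hom x y) (b : hom y z) : f \; b = g \; b -> f = g.
Proof. by move=> e; apply: (D_canc (a := idm x) (b := b)); rewrite !comp1m. Qed.

End Cancellative.

Definition is_length (C : category) (len : forall x y : C, hom x y -> nat) : Prop :=
  (forall (x y z : C) (f : hom x y) (g : hom y z),
      len _ _ (f \; g) = len _ _ f + len _ _ g) /\
  (forall (x y : C) (f : hom x y), len _ _ f = 0 <-> is_identity f).

(** In a category with finite lengths, and with central loops [nabla] such that
    every morphism divides a power of [nabla], joins of morphisms with a given source are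
    enough to obtain all the lattice operations, on both sides. *)
Section LatticesFromJoins.
Variables (D : category) (len : forall x y : D, hom x y -> nat).
Variable nabla : forall x : D, hom x x.
Hypotheses (lenP : is_length len) (D_canc : cancellative D).
Hypothesis nabla_central : forall (x y : D) (f : hom x y),
  f \; nabla y = nabla x \; f.
Hypothesis nabla_cofinal : forall (x y : D) (f : hom x y),
  exists m (g : hom y x), f \; g = loop_pow (nabla x) m.
Hypothesis joins : forall (x : D) (f g : mor_from x), exists j : mor_from x,
  [/\ le_from f j, le_from g j &
    forall c : mor_from x, le_from f c -> le_from g c -> le_from j c].

Lemma len_idm (x : D) : len (idm x) = 0.
Proof. by apply/lenP.2. Qed.

Lemma len_split_id (x y : D) (f : hom x y) (g : hom y x) :
  f \; g = idm x -> is_identity f /\ is_identity g.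
Proof.
move=> /(congr1 (@len x x)); rewrite lenP.1 len_idm => /eqP.
by rewrite addn_eq0 => /andP[/eqP/lenP.2 ? /eqP/lenP.2 ?].
Qed.

Lemma from_identity (x : D) (f g : mor_from x) (h : hom (tag f) (tag g)) :
  is_identity h -> tagged g = tagged f \; h -> f = g.
Proof.
case: f g h => [y f] [z g] /= h /esym/arrow_eqP[ey [ez ->]] -> /=.
by destruct ez; rewrite (Prop_irrelevance ey erefl) /= compm1.
Qed.

Lemma to_identity (x : D) (f g : mor_to x) (h : hom (tag f) (tag g)) :
  is_identity h -> tagged f = h \; tagged g -> f = g.
Proof.
case: f g h => [y f] [z g] /= h /esym/arrow_eqP[ey [ez ->]] -> /=.
by destruct ez; rewrite (Prop_irrelevance ey erefl) /= comp1m.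
Qed.

Lemma le_from_order (x : D) : Relation_Definitions.order (mor_from x) (@le_from D x).
Proof.
split=> [f|f g k [h e] [h' e']|f g [h e] [h' e']].
- by exists (idm _); rewrite compm1.
- by exists (h \; h'); rewrite e' e compmA.
- apply: (from_identity (h := h)) => //; apply: (proj1 (@len_split_id _ _ h h' _)).
  by apply: (comp_injl D_canc (a := tagged f)); rewrite compm1 compmA -e -e'.
Qed.

Lemma ge_to_order (x : D) : Relation_Definitions.order (mor_to x) (@ge_to D x).
Proof.
split=> [f|f g k [h e] [h' e']|f g [h e] [h' e']].
- by exists (idm _); rewrite comp1m.
- by exists (h \; h'); rewrite e e' compmA.
- apply: (to_identity (h := h)) => //; apply: (proj1 (@len_split_id _ _ h h' _)).
  by apply: (comp_injr D_canc (b := tagged f)); rewrite comp1m -compmA -e' -e.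
Qed.

(** The meet is a common left divisor of maximal length. The rank is the
    difference to the length of [f], since [meet_of_joins] minimizes. *)
Lemma lattice_from_joins (x : D) : is_lattice (@le_from D x).
Proof.
split=> [|f g]; first exact: le_from_order.
split; first exact: joins.
have le1 h : le_from (existT _ x (idm x)) h by exists (tagged h); rewrite comp1m.
apply: (@meet_of_joins _ _ f g _ (fun h => len (tagged f) - len (tagged h))
  (@le_from_order x) (@joins x) (le1 f) (le1 g)) => d e [h eh] [k ek].
have /andP[le_de le_ef] : len (tagged d) <= len (tagged e) <= len (tagged f).
  by rewrite ek eh !lenP.1 !leq_addr.
split=> [|/(congr1 (subn (len (tagged f))))]; first exact: leq_sub2l.
rewrite !subKn ?(leq_trans le_de) // => len_e; apply: (from_identity (h := h)) => //.
by apply/lenP.2; apply/(@addnI (len (tagged d))); rewrite -lenP.1 -eh addn0.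
Qed.

Lemma nabla_pow_central (x y : D) (f : hom x y) m :
  f \; loop_pow (nabla y) m = loop_pow (nabla x) m \; f.
Proof. by apply: loop_pow_comm; apply: nabla_central. Qed.

Lemma nabla_cofinal_right (x y : D) (f : hom y x) :
  exists m (g : hom x y), g \; f = loop_pow (nabla x) m.
Proof.
have [m [g e]] := nabla_cofinal f; exists m, g.
by apply: (comp_injl D_canc (a := f)); rewrite compmA e nabla_pow_central.
Qed.

Lemma nabla_cofinal_right2 (x y z : D) (f : hom y x) (g : hom z x) :
  exists m (f' : hom x y) (g' : hom x z),
    f' \; f = loop_pow (nabla x) m /\ g' \; g = loop_pow (nabla x) m.
Proof.
have [m [f' e]] := nabla_cofinal_right f.
have [n [g' e']] := nabla_cofinal_right g.
exists (m + n), (loop_pow (nabla x) n \; f'), (loop_pow (nabla x) m \; g').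
by rewrite -!compmA e e' -!loop_powD addnC.
Qed.

(** Complementation in a power of [nabla] reverses divisibility on the right
    into divisibility on the left, and so turns a least common multiple of
    complements into a greatest common right divisor. *)
Lemma to_joins (x : D) (f g : mor_to x) :
  exists j : mor_to x,
    [/\ ge_to f j, ge_to g j & forall c : mor_to x, ge_to f c -> ge_to g c -> ge_to j c].
Proof.
case: f g => [y f] [z g].
have [m [f' [g' [ef eg]]]] := nabla_cofinal_right2 f g.
have [[w j] [[a ja] [b jb] jP]] := joins (existT _ y f') (existT _ z g').
have [j' ej] : exists j', loop_pow (nabla x) m = j \; j'.
  by apply: (jP (existT _ x (loop_pow (nabla x) m))); [exists f | exists g].
rewrite /= in a ja b jb; exists (existT _ w j'); split=> /=.
- by exists a; apply: (comp_injl D_canc (a := f')); rewrite compmA -ja -ej.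
- by exists b; apply: (comp_injl D_canc (a := g')); rewrite compmA -jb -ej.
case=> t d [/= h eh] [/= k ek].
have efk : f' \; h = g' \; k.
  by apply: (comp_injr D_canc (b := d)); rewrite -!compmA -eh -ek ef eg.
have [l /= el] : @le_from D x (existT _ w j) (existT _ t (f' \; h)).
  by apply: jP; [exists h | exists k].
exists l; apply: (comp_injl D_canc (a := j)).
by rewrite compmA -el -ej -compmA -eh.
Qed.

(** In the order [ge_to], larger means shorter: its joins are the greatest
    common right divisors, and its meets are the common left multiples of
    minimal length, of which some power of [nabla] is an instance. *)
Lemma lattice_to_joins (x : D) : is_lattice (@ge_to D x).
Proof.
split=> [|f g]; first exact: ge_to_order.
split; first exact: to_joins.
have [m [f' [g' [ef eg]]]] := nabla_cofinal_right2 (tagged f) (tagged g).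
pose c : mor_to x := existT (fun y => hom y x) x (loop_pow (nabla x) m).
have le1 : ge_to c f by exists f'.
have le2 : ge_to c g by exists g'.
apply: (@meet_of_joins _ _ f g _ (fun h => len (tagged h)) (@ge_to_order x)
  (@to_joins x) le1 le2) => d e [h eh] _.
rewrite eh lenP.1; split=> [|len_d]; first exact: leq_addl.
apply: to_identity eh; apply/lenP.2; apply/(@addIn (len (tagged e))).
by rewrite -len_d.
Qed.

End LatticesFromJoins.

(** * Central Garside structures *)

(** A Garside structure whose automorphism is the identity. A length function is
    part of the data, because the length of a morphism bounds the power of
    [delta] that it divides ([divides_dpow]). *)
Record central_garside := CentralGarside {
  cg_cat :> category;
  delta : forall x : cg_cat, hom x x;
  len : forall x y : cg_cat, hom x y -> nat;
  delta_central : forall (x y : cg_cat) (f : hom x y), f \; delta y = delta x \; f;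
  lenP : is_length len;
  cg_cancellative : cancellative cg_cat;
  atom_divides_delta : forall (x y : cg_cat) (f : hom x y),
    is_atom f -> exists g, f \; g = delta x;
  cg_lattice_from : forall x : cg_cat, is_lattice (@le_from cg_cat x) }.

Arguments delta {c} x.
Arguments len {c x y} f.

Section CentralGarside.
Variable C : central_garside.
Implicit Types x y z : C.

Definition cg_injl := @comp_injl C (@cg_cancellative C).
Definition dpow x m : hom x x := loop_pow (delta x) m.

Lemma dpow_central x y (f : hom x y) m : f \; dpow y m = dpow x m \; f.
Proof. by apply: loop_pow_comm; apply: delta_central. Qed.

Lemma dpowD x m n : dpow x (m + n) = dpow x m \; dpow x n.
Proof. exact: loop_powD. Qed.

Lemma lenM x y z (f : hom x y) (g : hom y z) : len (f \; g) = len f + len g.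
Proof. exact: (lenP C).1. Qed.

Lemma len0 x y (f : hom x y) : len f = 0 <-> is_identity f.
Proof. exact: (lenP C).2. Qed.

(** A complement in a power of [delta] is built along a factorization into
    atoms, because the powers of [delta] are central. *)
Lemma divides_dpow x y (f : hom x y) m :
  len f <= m -> exists g : hom y x, f \; g = dpow x m.
Proof.
have [n le_n] := ubnP m; elim: n => // n IHn in x y f m le_n *.
have [/identity_iso[g [fg _]] _|nid_f] := pselect (is_identity f).
  by exists (g \; dpow x m); rewrite compmA fg comp1m.
case: m le_n => [_|m le_n le_f]; first by rewrite leqn0 => /eqP/len0.
rewrite ltnS in le_n.
have [f_atom|f_nonatom] := pselect (is_atom f).
  have [g fg] := atom_divides_delta f_atom.
  by exists (g \; dpow x m); rewrite compmA fg.
have [z [g [h [fgh ng nh]]]] : exists z (g : hom x z) (h : hom z y),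
    [/\ f = g \; h, ~ is_identity g & ~ is_identity h].
  apply: contrapT => no; apply: f_nonatom; split=> // z g h fgh.
  have [?|?] := pselect (is_identity g); first by left.
  have [?|?] := pselect (is_identity h); first by right.
  by case: no; exists z, g, h.
have g_gt0 : 0 < len g by rewrite lt0n; apply/eqP => /len0.
have h_gt0 : 0 < len h by rewrite lt0n; apply/eqP => /len0.
have le_gh : len g + len h <= m.+1 by rewrite -lenM -fgh.
have lt_g : len g < n.
  by apply: leq_trans le_n; apply: leq_trans le_gh; rewrite -addn1 leq_add2l.
have lt_h : m.+1 - len g < n.
  by apply: leq_trans le_n; rewrite ltn_subrL g_gt0.
have [g' gg'] := IHn _ _ g _ lt_g (leqnn _).
have le_h : len h <= m.+1 - len g.
  by rewrite leq_subRL // (leq_trans _ le_gh) ?leq_addr.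
have [h' hh'] := IHn _ _ h _ lt_h le_h.
exists (h' \; g'); rewrite fgh -compmA [h \; _]compmA hh'.
rewrite -dpow_central compmA gg' -dpowD subnKC //.
by apply: leq_trans le_gh; apply: leq_addr.
Qed.

Lemma from_join x y z (f : hom x y) (g : hom x z) :
  exists w (u : hom x w) (a : hom y w) (b : hom z w),
    [/\ f \; a = u, g \; b = u &
      forall t (c : hom x t) (a' : hom y t) (b' : hom z t),
        f \; a' = c -> g \; b' = c -> exists h, u \; h = c].
Proof.
have [[[w u] [[a ua] [b ub] uP]] _] :=
  (cg_lattice_from x).2 (existT _ y f) (existT _ z g).
exists w, u, a, b; split=> // t c a' b' fc gc.
have [h hc] := uP (existT _ t c) (ex_intro _ a' (esym fc)) (ex_intro _ b' (esym gc)).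
by exists h.
Qed.

(** The meet [v] of finitely many loops exists and is preserved by left
    translation. Indeed, if [d] divides all the [g \; f i], then so does the
    join of [d] and [g], and as this join has the form [g \; b], [b] divides
    all the [f i], hence [v]. *)
Lemma from_meet_loops x (n : nat) (f : nat -> hom x x) :
  exists y (v : hom x y),
    (forall i, i <= n -> exists a, v \; a = f i) /\
    (forall x0 (g : hom x0 x) t (d : hom x0 t),
      (forall i, i <= n -> exists a, d \; a = g \; f i) ->
      exists h, d \; h = g \; v).
Proof.
have [y [v [va vP]]] : exists y (v : hom x y),
    (forall i, i <= n -> exists a, v \; a = f i) /\
    (forall t (d : hom x t), (forall i, i <= n -> exists a, d \; a = f i) ->
      exists h, d \; h = v).
  elim: n => [|n [y [v [va vP]]]].
    exists x, (f 0); split=> [[|i] // _|t d]; last exact.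
    by exists (idm x); rewrite compm1.
  have [_ [[w u] [[a ua] [b ub] uP]]] :=
    (cg_lattice_from x).2 (existT _ y v) (existT _ x (f n.+1)).
  exists w, u; split=> [i|t d dP].
    rewrite leq_eqVlt => /orP[/eqP->|/va[c <-]]; first by exists b.
    by exists (a \; c); rewrite compmA -ua.
  have [h hv] : exists h, d \; h = v.
    by apply: vP => i le_in; apply: dP; apply: leqW.
  have [k kf] := dP n.+1 (leqnn _).
  have [l el] := uP (existT _ t d) (ex_intro _ h (esym hv)) (ex_intro _ k (esym kf)).
  by exists l.
exists y, v; split=> // x0 g t d dP.
have [w [u [a [b [ua ub uP]]]]] := from_join d g.
have [h hv] : exists h, b \; h = v.
  apply: vP => i /dP[c dc].
  have [h hc] := uP _ _ _ _ dc erefl; exists h.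
  by apply: (cg_injl (a := g)); rewrite compmA ub.
by exists (a \; h); rewrite compmA ua -ub -compmA hv.
Qed.

End CentralGarside.

(** * The divided category *)

(** The index category of a cyclic factorization into [r.+1] factors. Morphisms
    count steps around the circle, so that [r.+1] steps are a loop different
    from the identity. Characterizing the possible numbers of steps by a
    congruence, and not computing the target from the source and the number of
    steps, avoids all transports along equalities of indices. *)
Section Index.
Variable r : nat.

Definition steps (i j : 'I_r.+1) := {n : nat | i + n == j %[mod r.+1]}.

Lemma steps0_proof (i : 'I_r.+1) : i + 0 == i %[mod r.+1].
Proof. by rewrite addn0. Qed.

Lemma stepsD_proof (i j k : 'I_r.+1) m n :
  i + m == j %[mod r.+1] -> j + n == k %[mod r.+1] -> i + (m + n) == k %[mod r.+1].
Proof. by move=> /eqP ij /eqP jk; rewrite addnA -modnDml ij modnDml jk. Qed.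

Definition steps0 (i : 'I_r.+1) : steps i i := exist _ 0 (steps0_proof i).

Definition stepsD (i j k : 'I_r.+1) (m : steps i j) (n : steps j k) : steps i k :=
  exist _ (sval m + sval n) (stepsD_proof (svalP m) (svalP n)).

Lemma steps0D i j (n : steps i j) : stepsD (steps0 i) n = n.
Proof. exact: val_inj. Qed.

Lemma stepsD0 i j (n : steps i j) : stepsD n (steps0 j) = n.
Proof. by apply: val_inj; rewrite /= addn0. Qed.

Lemma stepsDA i j k l (m : steps i j) (n : steps j k) (p : steps k l) :
  stepsD m (stepsD n p) = stepsD (stepsD m n) p.
Proof. by apply: val_inj; rewrite /= addnA. Qed.

Definition cyc : category := Category steps0D stepsD0 stepsDA.

Definition Steps (i j : cyc) n (ij : i + n == j %[mod r.+1]) : hom i j :=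
  exist _ n ij.

Lemma succ_proof (i j : 'I_r.+1) n :
  i + n == j %[mod r.+1] -> ordS i + n == ordS j %[mod r.+1].
Proof.
by move=> /eqP ij; rewrite /= modnDml modn_mod addSn -addn1 -modnDml ij modnDml addn1.
Qed.

Lemma step1_proof (i : 'I_r.+1) : i + 1 == ordS i %[mod r.+1].
Proof. by rewrite addn1 /= modn_mod. Qed.

Definition step1 (i : cyc) : hom i (ordS i : cyc) := Steps (step1_proof i).

Lemma pred_step1_proof (i : 'I_r.+1) : ord_pred i + 1 == i %[mod r.+1].
Proof. by have := step1_proof (ord_pred i); rewrite ord_predK. Qed.

Definition pred_step1 (i : cyc) : hom (ord_pred i : cyc) i :=
  Steps (pred_step1_proof i).

Lemma pred_proof (i j : 'I_r.+1) n :
  i + n == j %[mod r.+1] -> ord_pred i + n == ord_pred j %[mod r.+1].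
Proof.
move=> ij; rewrite -(eqn_modDr 1) (eqP (pred_step1_proof j)) addnAC.
by rewrite -modnDml (eqP (pred_step1_proof i)) modnDml.
Qed.

Definition succ_functor : functor cyc cyc.
Proof.
refine (@Functor cyc cyc (@ordS r.+1)
  (fun i j n => Steps (succ_proof (svalP n))) _ _).
- by move=> i; apply: val_inj.
- by move=> i j k m n; apply: val_inj.
Defined.

Definition pred_functor : functor cyc cyc.
Proof.
refine (@Functor cyc cyc (@ord_pred r.+1)
  (fun i j n => Steps (pred_proof (svalP n))) _ _).
- by move=> i; apply: val_inj.
- by move=> i j k m n; apply: val_inj.
Defined.

Lemma steps_inj (i j : cyc) (m n : hom i j) : sval m = sval n -> m = n.
Proof. exact: val_inj. Qed.

Lemma one_step_source (i j : cyc) (n : hom i j) : sval n = 1 -> i = ord_pred j.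
Proof.
move=> n1; have := svalP n; rewrite n1 => /eqP e.
rewrite -[LHS](@ordSK r.+1); congr ord_pred; apply: val_inj.
by rewrite /= -addn1 e modn_small.
Qed.

Lemma cyc_arrow_eq (i j i' j' : cyc) (m : hom i j) (n : hom i' j') :
  i = i' -> j = j' -> sval m = sval n -> Arrow m = Arrow n.
Proof. by move=> ei ej; subst i' j' => /steps_inj ->. Qed.

End Index.

Lemma dep_choice (I : Type) (P : I -> Type) (Q : forall i, P i -> Prop) :
  (forall i, exists p, Q i p) -> exists p : forall i, P i, forall i, Q i (p i).
Proof. by move=> e; exists (fun i => sval (cid (e i))) => i; case: cid. Qed.

Section Divided.
Variables (C : central_garside) (r : nat).

(** A cyclic sequence of [r.+1] morphisms, the images of the single steps, whose
    product over one turn is [delta] from wherever it starts. *)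
Record divided_ob := DividedOb {
  div_functor :> functor (cyc r) C;
  div_turn : forall (i : cyc r) (n : hom i i),
    sval n = r.+1 -> fmap div_functor n = delta (div_functor i) }.

Record divided_hom (F G : divided_ob) := DividedHom {
  div_mor :> forall i : cyc r, hom (F i) (G i);
  div_natural : forall (i j : cyc r) (n : hom i j),
    fmap F n \; div_mor j = div_mor i \; fmap G n }.

Lemma divided_ob_ext (F G : divided_ob) : functor_eq F G -> F = G.
Proof.
case: F G => [F Ft] [G Gt] /= /functor_ext FG.
by case: _ / FG in Gt *; congr DividedOb; apply: Prop_irrelevance.
Qed.

Lemma divided_hom_ext (F G : divided_ob) (f g : divided_hom F G) :
  (forall i, f i = g i) -> f = g.
Proof.
case: f g => [f fn] [g gn] /= e.
have fg : f = g by apply: functional_extensionality_dep.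
by case: _ / fg in gn e *; congr DividedHom; apply: Prop_irrelevance.
Qed.

Definition divided_id (F : divided_ob) : divided_hom F F.
Proof. by exists (fun i => idm (F i)) => i j n; rewrite comp1m compm1. Defined.

Definition divided_comp (F G H : divided_ob) (f : divided_hom F G)
  (g : divided_hom G H) : divided_hom F H.
Proof.
exists (fun i => f i \; g i) => i j n.
by rewrite compmA div_natural -compmA div_natural compmA.
Defined.

Definition divided : category.
Proof.
refine (@Category divided_ob divided_hom divided_id divided_comp _ _ _).
- by move=> F G f; apply: divided_hom_ext => i; apply: comp1m.
- by move=> F G f; apply: divided_hom_ext => i; apply: compm1.
- by move=> F G H K f g h; apply: divided_hom_ext => i; apply: compmA.
Defined.

Implicit Types F G H : divided.

Lemma divided_arrow_ext (F G F' G' : divided_ob) (f : divided_hom F G)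
    (f' : divided_hom F' G') :
  functor_eq F F' -> functor_eq G G' -> (forall i, Arrow (f i) = Arrow (f' i)) ->
  @Arrow divided F G f = @Arrow divided F' G' f'.
Proof.
move=> /divided_ob_ext eF /divided_ob_ext eG; subst F' G' => ff'.
by congr Arrow; apply: divided_hom_ext => i; apply/arrow_inj/ff'.
Qed.

(** By naturality, a morphism whose components are identities has source and
    target equal as functors. *)
Lemma divided_identity (F G : divided) (f : hom F G) :
  (forall i, is_identity (f i)) -> is_identity f.
Proof.
move=> f1; have FG : functor_eq F G.
  move=> i j n; have -> : Arrow (fmap F n) = Arrow (fmap F n \; f j).
    by rewrite -[in LHS](compm1 (fmap F n)); apply: arrow_comp => //; rewrite f1.
  rewrite div_natural -[RHS]/(Arrow (fmap G n)) -[in RHS](comp1m (fmap G n)).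
  apply: arrow_comp => //; rewrite f1; apply: arrow_idm.
  by have := congr1 (@target _) (f1 i).
by apply: divided_arrow_ext => //= i j n; rewrite FG.
Qed.

Lemma div_pow (F : divided_ob) (i : cyc r) (n : hom i i) m :
  sval n = m * r.+1 -> fmap F n = dpow (F i) m.
Proof.
elim: m => [|m IHm] in n *.
  by move=> n0; rewrite (_ : n = idm i) ?fmap1 //; apply: steps_inj.
move=> nE.
have turn : i + r.+1 == i %[mod r.+1] by rewrite modnDr.
have turns : i + m * r.+1 == i %[mod r.+1] by rewrite addnC modnMDl.
rewrite (_ : n = Steps turn \; Steps turns).
  by rewrite fmapM (@div_turn F i (Steps turn)) // IHm.
by apply: steps_inj; rewrite nE mulSn.
Qed.

(** ** Divisibility in the divided category is pointwise *)

Lemma divided_cancellative : cancellative divided.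
Proof.
move=> F G H K a f g b e; apply: divided_hom_ext => i.
apply: (cg_cancellative (a := a i) (b := b i)).
exact: (congr1 (fun h : divided_hom F K => h i) e).
Qed.

(** The quotients exist componentwise; by cancellation they are natural. *)
Lemma divided_divides F G H (f : hom F G) (g : hom F H) :
  (forall i, exists h, f i \; h = g i) -> exists h : hom G H, f \; h = g.
Proof.
move=> /dep_choice[h fh].
have h_nat i j (n : hom i j) : fmap G n \; h j = h i \; fmap H n.
  apply: (cg_injl (a := f i)).
  by rewrite !compmA -div_natural -compmA !fh div_natural.
by exists (@DividedHom G H h h_nat); apply: divided_hom_ext.
Qed.

(** A family of morphisms [u i] out of the objects [F i] is a morphism of the
    divided category out of [F] as soon as [u i] divides [fmap F n \; u j] for
    all paths [n] from [i] to [j]: cancellation makes the target a functor, and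
    centrality of [delta] makes it send a turn to [delta]. *)
Section Target.
Variables (F : divided_ob) (W : cyc r -> C) (u : forall i, hom (F i) (W i)).
Hypothesis u_le : forall (i j : cyc r) (n : hom i j),
  exists w, u i \; w = fmap F n \; u j.

Definition target_map (i j : cyc r) (n : hom i j) : hom (W i) (W j) :=
  sval (cid (u_le n)).

Lemma target_mapE i j (n : hom i j) : u i \; target_map n = fmap F n \; u j.
Proof. by rewrite /target_map; case: cid. Qed.

Definition target_functor : functor (cyc r) C.
Proof.
refine (@Functor _ _ W target_map _ _).
- move=> i; apply: (cg_injl (a := u i)).
  by rewrite target_mapE fmap1 comp1m compm1.
- move=> i j k m n; apply: (cg_injl (a := u i)).
  by rewrite compmA !target_mapE -compmA target_mapE fmapM compmA.
Defined.

Lemma target_turn (i : cyc r) (n : hom i i) :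
  sval n = r.+1 -> fmap target_functor n = delta (W i).
Proof.
move=> nE; apply: (cg_injl (a := u i)).
by rewrite target_mapE (@div_turn F _ _ nE) delta_central.
Qed.

Definition target_ob : divided_ob := DividedOb target_turn.

Definition target_hom : divided_hom F target_ob :=
  @DividedHom F target_ob u (fun i j n => esym (target_mapE n)).

End Target.

(** Componentwise joins satisfy the condition of [target_ob] by their universal
    property. Universality in each component is stronger than universality among
    morphisms of the divided category; [step1_absorbing] works componentwise. *)
Lemma divided_join F G H (f : hom F G) (g : hom F H) :
  exists (W : divided) (u : hom F W) (a : hom G W) (b : hom H W),
    [/\ f \; a = u, g \; b = u &
      forall i t (c : hom (F i) t), (exists a', f i \; a' = c) ->
        (exists b', g i \; b' = c) -> exists h, u i \; h = c].
Proof.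
have := fun i => from_join (f i) (g i).
move=> /dep_choice[W] /dep_choice[u] /dep_choice[a] /dep_choice[b uP].
have u_le i j (n : hom i j) : exists v, u i \; v = fmap F n \; u j.
  have [_ _ ui] := uP i; have [fa gb _] := uP j.
  apply: (ui _ _ (fmap G n \; a j) (fmap H n \; b j)).
  - by rewrite compmA -div_natural -compmA fa.
  - by rewrite compmA -div_natural -compmA gb.
pose U : hom F (target_ob u_le : divided) := target_hom u_le.
have [A fA] : exists A, f \; A = U.
  by apply: divided_divides => i; exists (a i); case: (uP i).
have [B gB] : exists B, g \; B = U.
  by apply: divided_divides => i; exists (b i); case: (uP i).
exists (target_ob u_le), U, A, B; split=> // i t c [a' fc] [b' gc].
by have [_ _ ui] := uP i; apply: ui fc gc.
Qed.

Lemma divided_joins F (f g : mor_from F) : exists j : mor_from F,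
  [/\ le_from f j, le_from g j &
    forall c : mor_from F, le_from f c -> le_from g c -> le_from j c].
Proof.
case: f g => [G f] [H g]; have [W [u [a [b [fa gb uP]]]]] := divided_join f g.
exists (existT _ W u); split=> [||[K c] [/= a' fc] [/= b' gc]].
- by exists a.
- by exists b.
have [h uh] : exists h, u \; h = c.
  apply: divided_divides => i; apply: uP.
  - by exists ((a' : divided_hom _ _) i); rewrite fc.
  - by exists ((b' : divided_hom _ _) i); rewrite gc.
by exists h.
Qed.

(** ** The Garside structure of the divided category *)

Definition divided_len F G (f : hom F G) := \sum_(i < r.+1) len ((f : divided_hom F G) i).

Lemma divided_lenP : is_length divided_len.
Proof.
split=> [F G H f g|F G f].
  by rewrite /divided_len -big_split; apply: eq_bigr => i _; rewrite lenM.
split=> [/eqP|f1].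
  rewrite /divided_len sum_nat_eq0 => /forallP f0; apply: divided_identity => i.
  by apply/len0/eqP/f0.
rewrite /divided_len big1 // => i _; apply/len0.
by rewrite /is_identity (congr1 (fun a : arrow divided => Arrow (div_mor (mor a) i)) f1).
Qed.

(** The turns. They are the [r.+1]-st powers of the Garside elements, but unlike
    these they are loops, hence usable as [nabla] in [lattice_to_joins]. *)
Definition divided_delta (F : divided) : hom F F.
Proof.
exists (fun i => delta (F i)) => i j n; exact: delta_central.
Defined.

Lemma divided_delta_pow F m i :
  (loop_pow (divided_delta F) m : divided_hom F F) i = dpow (F i) m.
Proof. by elim: m => //= m ->. Qed.

Lemma divided_delta_central F G (f : hom F G) :
  f \; divided_delta G = divided_delta F \; f.
Proof. by apply: divided_hom_ext => i; apply: delta_central. Qed.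

Lemma divided_delta_cofinal F G (f : hom F G) :
  exists m (g : hom G F), f \; g = loop_pow (divided_delta F) m.
Proof.
exists (divided_len f); apply: divided_divides => i.
rewrite divided_delta_pow; apply: divides_dpow.
by rewrite /divided_len (bigD1 i) //= leq_addr.
Qed.

Definition preserves_steps (s : functor (cyc r) (cyc r)) : Prop :=
  forall (i j : cyc r) (n : hom i j), sval (fmap s n) = sval n.

Definition shift_ob s (sE : preserves_steps s) (F : divided_ob) :
  divided_ob.
Proof.
exists (functor_comp s F) => i n nE /=; apply: div_turn.
by rewrite sE.
Defined.

Definition shift s (sE : preserves_steps s) : functor divided divided.
Proof.
refine (@Functor divided divided (shift_ob sE)
  (fun F G f => @DividedHom (shift_ob sE F) (shift_ob sE G)
     (fun i => (f : divided_hom F G) (s i)) (fun i j n => div_natural f (fmap s n))) _ _).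
- by move=> F; apply: divided_hom_ext.
- by move=> F G H f g; apply: divided_hom_ext.
Defined.

Lemma shiftK s t (sE : preserves_steps s) (tE : preserves_steps t) :
  (forall i, s (t i) = i) ->
  functor_eq (functor_comp (shift sE) (shift tE)) (functor_id divided).
Proof.
move=> stK F G f.
have shift_eq (H : divided_ob) : functor_eq (shift_ob tE (shift_ob sE H)) H.
  move=> i j n /=; apply: arrow_fmap.
  by apply: cyc_arrow_eq; [exact: stK | exact: stK | by rewrite sE tE].
apply: divided_arrow_ext; [exact: shift_eq | exact: shift_eq | move=> i /=].
by rewrite stK.
Qed.

Definition phi_div : functor divided divided :=
  @shift (succ_functor r) (fun _ _ _ => erefl).
Definition psi_div : functor divided divided :=
  @shift (pred_functor r) (fun _ _ _ => erefl).

Lemma phi_div_auto : is_automorphism phi_div.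
Proof.
by exists psi_div; split; apply: shiftK => i; [apply: ord_predK | apply: ordSK].
Qed.

Definition Delta_div (F : divided) : hom F (phi_div F).
Proof.
exists (fun i => fmap F (step1 i)) => i j n /=; rewrite -!fmapM.
by congr (fmap _ _); apply: steps_inj; rewrite /= addnC.
Defined.

Lemma Delta_div_natural F G (f : hom F G) :
  f \; Delta_div G = Delta_div F \; fmap phi_div f.
Proof. by apply: divided_hom_ext => i /=; rewrite div_natural. Qed.

(** This has the same components as [Delta_div (psi_div F)], but its target is
    [F] by definition and not only by a propositional equality. *)
Definition pred_Delta_div (F : divided) : hom (psi_div F) F.
Proof.
exists (fun i => fmap F (pred_step1 i)) => i j n /=; rewrite -!fmapM.
by congr (fmap _ _); apply: steps_inj; rewrite /= addnC.
Defined.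

Lemma pred_Delta_div_natural F G (f : hom F G) :
  pred_Delta_div F \; f = fmap psi_div f \; pred_Delta_div G.
Proof. by apply: divided_hom_ext => i /=; rewrite div_natural. Qed.

(** Say that [c] absorbs [f] along [n : i -> j] if [c] is divisible by
    [fmap F n \; f j] whenever it is divisible by [fmap F n] and by [f i].
    Absorption along single steps implies, step by step, absorption along all
    paths. Now take for [n] a number [m] of turns with [f i] dividing
    [delta^m], and [c = delta^m]: then [delta^m \; f i] divides [delta^m], and
    [f i] is an identity. *)
Lemma step1_absorbing F G (f : hom F G) :
    (forall (i j : cyc r) (n : hom i j) t (c : hom (F i) t), sval n = 1 ->
      (exists h, fmap F n \; h = c) -> (exists h, div_mor f i \; h = c) ->
      exists h, (fmap F n \; div_mor f j) \; h = c) ->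
  is_identity f.
Proof.
move=> abs1; have abs m i j (n : hom i j) t (c : hom (F i) t) : sval n = m ->
      (exists h, fmap F n \; h = c) -> (exists h, div_mor f i \; h = c) ->
      exists h, (fmap F n \; div_mor f j) \; h = c.
  elim: m => [|m IHm] in i j n t c *.
    move=> n0 _ [h fh]; have ij : i = j.
      have /= := svalP n; rewrite n0 addn0 !modn_small // => /eqP.
      exact: val_inj.
    subst j; rewrite (_ : n = idm i); last exact: steps_inj.
    by exists h; rewrite fmap1 comp1m.
  move=> nE [h nh] fc.
  have n'P : ordS i + m == j %[mod r.+1].
    by rewrite /= modnDml addSnnS -nE; apply: (svalP n).
  pose n' : hom (ordS i : cyc r) j := Steps n'P.
  have nn' : n = step1 i \; n' by apply: steps_inj; rewrite /= nE.
  rewrite nn' fmapM -!compmA in nh *.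
  have [k] := abs1 _ _ (step1 i) _ c erefl (ex_intro _ _ nh) fc.
  rewrite -nh -compmA => /(cg_injl (C := C)) fk.
  have [l el] := IHm _ _ n' _ (fmap F n' \; h) erefl
    (ex_intro _ h erefl) (ex_intro _ k fk).
  by exists l; rewrite -el !compmA.
apply: divided_identity => i; apply/len0.
have [m [g fg]] := divided_delta_cofinal f.
have fgi : f i \; (g : divided_hom _ _) i = dpow (F i) m.
  by rewrite -divided_delta_pow -fg.
have turns : i + m * r.+1 == i %[mod r.+1] by rewrite addnC modnMDl.
pose n := Steps turns.
have nE : fmap F n = dpow (F i) m by apply: div_pow.
have [h] := abs _ _ _ n _ (dpow (F i) m) erefl
  (ex_intro _ (idm _) (etrans (compm1 _) nE)) (ex_intro _ _ fgi).
move=> /(congr1 (fun f => len f)); rewrite nE !lenM -addnA -[RHS]addn0 => /addnI/eqP.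
by rewrite addn_eq0 => /andP[/eqP].
Qed.

(** Shift [f : F -> G] back by one step and take its join [W] with the step to
    [F]. As [W] lies between [F] and [G], and [f] is an atom, [W] is one of
    them. If it is [F], then the shifted [f] divides the step, that is, [f] is
    simple. If it is [G], then common multiples of the shifted [f] and
    of the step absorb [f], and [step1_absorbing] contradicts that [f] is no identity. *)
Lemma divided_atom_simple F G (f : hom F G) : is_atom f -> is_simple Delta_div f.
Proof.
move=> [nid_f f_atom].
have [W [u [a [b [ea eb uP]]]]] := divided_join (pred_Delta_div F) (fmap psi_div f).
have [c [ac bc]] : exists c : hom W G, a \; c = f /\ b \; c = pred_Delta_div G.
  have [c uc] : exists c : hom W G, u \; c = pred_Delta_div F \; f.
    apply: divided_divides => i; apply: uP; first by exists (f i).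
    by exists (pred_Delta_div G i); rewrite pred_Delta_div_natural.
  exists c; split.
  - by apply: (comp_injl divided_cancellative (a := pred_Delta_div F)); rewrite compmA ea.
  - apply: (comp_injl divided_cancellative (a := fmap psi_div f)).
    by rewrite compmA eb uc pred_Delta_div_natural.
have [/identity_iso[a' [aa' _]]|/identity_iso[c' [cc' _]]] := f_atom _ _ _ (esym ac).
(* [fmap psi_div f] divides the step with quotient [b \; a'] *)
- have hP (j k : cyc r) (n : hom j k) : sval n = 1 -> exists h, f j \; h = fmap F n.
    move=> n1; have jk := one_step_source n1; subst j.
    rewrite (_ : n = pred_step1 k); last exact: steps_inj.
    have e : fmap psi_div f \; (b \; a') = pred_Delta_div F.
      by rewrite compmA eb -ea -compmA aa' compm1.
    exists ((b \; a' : divided_hom _ _) k).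
    by rewrite -[RHS](congr1 (fun h : divided_hom _ _ => h k) e).
  by apply: divided_divides => i; apply: hP.
(* [a] is [f \; c'], so that the join [u] is a multiple of [f] after a step *)
- case: nid_f; apply: step1_absorbing => j k n t d n1 [x nx] [y fy].
  have jk := one_step_source n1; subst j.
  rewrite (_ : n = pred_step1 k) in nx *; last exact: steps_inj.
  have [h uh] := uP k t d (ex_intro _ x nx) (ex_intro _ y fy); exists (div_mor c' k \; h).
  have fc : f \; c' = a by rewrite -ac -compmA cc' compm1.
  rewrite -uh -ea -fc /= !compmA //.
Qed.

End Divided.

Definition divided_garside (C : central_garside) (r : nat) : garside_structure.
Proof.
refine (@GarsideStructure (divided C r) (phi_div C r) (@Delta_div C r)
  (phi_div_auto C r) (@Delta_div_natural C r) (ex_intro _ _ (@divided_lenP C r))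
  (@divided_cancellative C r) (@divided_atom_simple C r)
  (lattice_from_joins (@divided_lenP C r) (@divided_cancellative C r)
    (@divided_joins C r))
  (lattice_to_joins (@divided_lenP C r) (@divided_cancellative C r)
    (@divided_delta_central C r) (@divided_delta_cofinal C r) (@divided_joins C r))).
Defined.

(** * Localization *)

Lemma iso_injl (C : category) (x y z : C) (a : hom x y) (f g : hom y z) :
  is_iso a -> a \; f = a \; g -> f = g.
Proof.
by move=> [b [_ ba]] e; rewrite -(comp1m f) -(comp1m g) -ba -!compmA e.
Qed.

Lemma fmap_loop_pow (C D : category) (F : functor C D) (x : C) (f : hom x x) n :
  fmap F (loop_pow f n) = loop_pow (fmap F f) n.
Proof. by elim: n => [|n IHn] /=; rewrite ?fmap1 // fmapM IHn. Qed.

Lemma fmap_square (C D : category) (F : functor C D) (x y y' z : C)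
    (f : hom x y) (g : hom y z) (f' : hom x y') (g' : hom y' z) :
  f \; g = f' \; g' -> fmap F f \; fmap F g = fmap F f' \; fmap F g'.
Proof. by move=> e; rewrite -!fmapM e. Qed.

Lemma loop_pow_mul (C : category) (x : C) (f g : hom x x) n :
  f \; g = g \; f -> loop_pow (f \; g) n = loop_pow f n \; loop_pow g n.
Proof.
move=> fg; elim: n => [|n IHn] /=; first by rewrite comp1m.
rewrite IHn -!compmA; congr (_ \; _); rewrite !compmA; congr (_ \; _).
exact: loop_pow_comm.
Qed.

Section Naturality.
Variables (C D : category) (G G' : functor C D) (eta : forall x : C, hom (G x) (G' x)).

Definition natural_at (x y : C) (a : hom x y) : Prop :=
  fmap G a \; eta y = eta x \; fmap G' a.

Lemma natural_at_idm (x : C) : natural_at (idm x).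
Proof. by rewrite /natural_at !fmap1 comp1m compm1. Qed.

Lemma natural_at_comp (x y z : C) (a : hom x y) (b : hom y z) :
  natural_at a -> natural_at b -> natural_at (a \; b).
Proof.
by rewrite /natural_at => ea eb; rewrite !fmapM -compmA eb compmA ea compmA.
Qed.

Lemma natural_at_inv (x y : C) (a : hom x y) (b : hom y x) :
  a \; b = idm x /\ b \; a = idm y -> natural_at a -> natural_at b.
Proof.
rewrite /natural_at => -[ab ba] ea.
rewrite -[LHS]compm1 -fmap1 -ab fmapM -!compmA (compmA (eta x)) -ea.
by rewrite !compmA -fmapM ba fmap1 comp1m.
Qed.

End Naturality.

(** Naturality holds for composites and for inverses of morphisms for which it
    holds, so it is enough to check it before localization. *)
Lemma loc_natural (C D : category) (G G' : functor (localization C) D)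
    (eta : forall x : localization C, hom (G x) (G' x)) :
    (forall (x y : C) (f : hom x y), natural_at eta (fmap (loc_functor C) f)) ->
  forall (x y : localization C) (a : hom x y), natural_at eta a.
Proof.
move=> eta_nat; apply: loc_ind => [x|x y z f a IH|x y z f a IH].
- exact: natural_at_idm.
- exact: natural_at_comp (eta_nat _ _ f) IH.
- exact: natural_at_comp (natural_at_inv (loc_fmapV f) (eta_nat _ _ f)) IH.
Qed.

Section LocMap.
Variables (C D : category) (F : functor C D).

Let eval := zz_eval (@localization_groupoid D) (functor_comp F (loc_functor D)).

Lemma eval_class (x y : C) (u : zigzag x y) : eval (loc_repr (loc_class u)) = eval u.
Proof. by apply: zz_eval_eq; apply: loc_repr_class. Qed.

(** The extension of functors along the localization, chosen so that it acts on
    objects as [F] does by definition. *)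
Definition loc_map : functor (localization C) (localization D).
Proof.
refine (@Functor (localization C) (localization D) F
  (fun x y a => eval (loc_repr a)) _ _).
- by move=> x; rewrite eval_class.
- move=> x y z a b; rewrite -(loc_reprK a) -(loc_reprK b) /= loc_compE.
  by rewrite !eval_class /eval zz_eval_cat.
Defined.

Lemma loc_mapE (x y : C) (f : hom x y) :
  fmap loc_map (fmap (loc_functor C) f) = fmap (loc_functor D) (fmap F f).
Proof. by rewrite /= eval_class /eval /=; apply: (compm1 (c := localization D)). Qed.

End LocMap.

(** Localization makes every natural transformation invertible, so that any
    [s] and [t] exhibit the localized functors as inverse to each other. *)
Lemma loc_equivalence (C D : category) (F : functor C D) (G : functor D C)
    (s : forall x : C, hom (G (F x)) x) (t : forall y : D, hom (F (G y)) y) :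
    (forall (x x' : C) (f : hom x x'), fmap G (fmap F f) \; s x' = s x \; f) ->
    (forall (y y' : D) (g : hom y y'), fmap F (fmap G g) \; t y' = t y \; g) ->
  is_equivalence (loc_map F).
Proof.
move=> s_nat t_nat; exists (loc_map G); split.
- exists (fun x => fmap (loc_functor C) (s x)); split=> [x|].
    by exists (loc_inv (s x)); apply: loc_fmapV.
  apply: (@loc_natural C _ (functor_comp (loc_map F) (loc_map G)) (functor_id _)
    (fun x : C => fmap (loc_functor C) (s x))) => x y f.
  rewrite /natural_at.
  rewrite -[fmap (functor_comp _ _) _]/(fmap (loc_map G) (fmap (loc_map F) _)).
  by rewrite !loc_mapE; exact: (fmap_square (loc_functor C) (s_nat _ _ f)).
- exists (fun x => fmap (loc_functor D) (t x)); split=> [x|].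
    by exists (loc_inv (t x)); apply: loc_fmapV.
  apply: (@loc_natural D _ (functor_comp (loc_map G) (loc_map F)) (functor_id _)
    (fun x : D => fmap (loc_functor D) (t x))) => x y f.
  rewrite /natural_at.
  rewrite -[fmap (functor_comp _ _) _]/(fmap (loc_map F) (fmap (loc_map G) _)).
  by rewrite !loc_mapE; exact: (fmap_square (loc_functor D) (t_nat _ _ f)).
Qed.

(** * Fractions and periodic loops *)

Section Fractions.
Variable C : central_garside.
Implicit Types x y z : C.

Definition compl x y (f : hom x y) : hom y x := sval (cid (divides_dpow (leqnn (len f)))).

Lemma complR x y (f : hom x y) : f \; compl f = dpow x (len f).
Proof. by rewrite /compl; case: cid. Qed.

Lemma complL x y (f : hom x y) : compl f \; f = dpow y (len f).
Proof. by apply: (cg_injl (a := f)); rewrite compmA complR dpow_central. Qed.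

(** A calculus of fractions with powers of the central [delta] as denominators:
    [(m, f)] stands for the value [delta^-m f] of the zigzag, and the inverse
    of [f] is [delta^-(len f) (compl f)]. *)
Fixpoint frac x y (u : zigzag x y) : nat * hom x y :=
  match u in zigzag x y return nat * hom x y with
  | zz_nil x => (0, idm x)
  | zz_fwd _ _ _ f w => ((frac w).1, f \; (frac w).2)
  | zz_bwd _ _ _ f w => (len f + (frac w).1, compl f \; (frac w).2)
  end.

(** Equivalent zigzags have equal fractions: this is what makes the category
    embed into its localization. *)
Lemma frac_eq x y (u v : zigzag x y) : zz_eq u v ->
  dpow x (frac v).1 \; (frac u).2 = dpow x (frac u).1 \; (frac v).2.
Proof.
elim=> //= {x y u v}.
- move=> x y u v w _ uv _ vw; apply: (cg_injl (a := dpow x (frac v).1)).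
  rewrite !compmA -!dpowD [in LHS]addnC dpowD -compmA uv.
  by rewrite compmA -dpowD [in LHS]addnC dpowD -compmA vw compmA -dpowD addnC.
- by move=> x y z f u v _ e; rewrite !compmA -!dpow_central -!compmA e.
- move=> x y z f u v _ e; rewrite !compmA -!dpow_central -!compmA !dpowD -!compmA.
  by rewrite e.
- by move=> x y u; rewrite comp1m.
- by move=> x y z t f g u; rewrite !compmA.
- by move=> x y z f u; rewrite (compmA f) complR compmA -dpowD addnC.
- by move=> x y z f u; rewrite (compmA _ f) complL compmA -dpowD addnC.
Qed.

Lemma loc_faithful x y (f g : hom x y) :
  fmap (loc_functor C) f = fmap (loc_functor C) g -> f = g.
Proof. by move=> /loc_classP/frac_eq /=; rewrite !comp1m !compm1. Qed.

Lemma loc_delta_central x y (a : @hom (localization C) x y) m :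
  a \; fmap (loc_functor C) (dpow y m) = fmap (loc_functor C) (dpow x m) \; a.
Proof.
apply: (@loc_natural C _ (functor_id _) (functor_id _)
  (fun x : C => fmap (loc_functor C) (dpow x m))) => {a}x {}y f.
by rewrite /natural_at; exact: (fmap_square (loc_functor C) (dpow_central f m)).
Qed.

Lemma loc_fraction x y (a : @hom (localization C) x y) :
  exists m (f : hom x y),
    fmap (loc_functor C) (dpow x m) \; a = fmap (loc_functor C) f.
Proof.
move: x y a; apply: loc_ind => [x|x y z f a [m [g e]]|x y z f a [m [g e]]].
- by exists 0, (idm x); rewrite compm1.
- by exists m, (f \; g); rewrite fmapM -e !compmA -!fmapM dpow_central.
- exists (len f + m), (compl f \; g); rewrite fmapM -e.
  rewrite addnC dpowD -complL !fmapM -!compmA (compmA _ (loc_inv f)) (loc_fmapV f).1.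
  by rewrite comp1m !compmA -!fmapM dpow_central.
Qed.

(** With [gamma = delta^-m g], the hypothesis is [gamma^(r+1) = delta] and the
    conclusion is [gamma v = v h]. The loops [f i] of the proof are the powers
    [gamma^i], for [i <= r], multiplied by [delta^(m * r)] to lie in the
    category. Multiplication by [gamma] takes each to the next one, and the
    last to [delta] times the first, so that their meet [v] divides all the
    [gamma f i], hence [gamma v], by [from_meet_loops]. *)
Lemma periodic_loop_positive x (g : hom x x) m r :
    loop_pow g r.+1 = dpow x (m * r.+1).+1 ->
  exists y (v : hom x y) (h : hom y y),
    g \; v = (dpow x m \; v) \; h /\ loop_pow h r.+1 = delta y.
Proof.
move=> g_periodic.
pose f i := dpow x (m * (r - i)) \; loop_pow g i.
have [y [v [va vP]]] := from_meet_loops r f.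
have [h hE] : exists h, (dpow x m \; v) \; h = g \; v.
  apply: vP => i le_ir; rewrite /f compmA dpow_central -compmA.
  rewrite -[g \; loop_pow g i]/(loop_pow g i.+1).
  have [lt_ir|le_ri] := ltnP i r.
    have [a e] := va _ lt_ir; exists a; rewrite -compmA e /f compmA -dpowD.
    by rewrite -mulnS subnSK.
  have -> : i = r by apply/eqP; rewrite eqn_leq le_ir.
  have [a e] := va 0 isT; exists (a \; delta x).
  rewrite subnn muln0 comp1m g_periodic -!compmA (compmA v) e /f subn0 /= compm1.
  by rewrite compmA -dpowD -mulnS delta_central.
exists y, v, h; split=> //; apply: (cg_injl (a := v)).
have gnv n : loop_pow g n \; v = dpow x (m * n) \; (v \; loop_pow h n).
  elim: n => [|n IHn] /=; first by rewrite muln0 !comp1m compm1.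
  rewrite -compmA IHn compmA dpow_central -compmA (compmA g) -hE.
  by rewrite -!compmA (compmA (dpow x (m * n))) -dpowD addnC -mulnS.
apply: (cg_injl (a := dpow x (m * r.+1))).
rewrite -gnv g_periodic delta_central compmA -addn1 dpowD.
by rewrite /dpow /= compm1.
Qed.

End Fractions.

(** * The divided groupoid is equivalent to the original one *)

Section Iota.
Variables (C : central_garside) (r : nat).

(** The factorization of [delta x] whose only nontrivial factor is the last one:
    a path from [i] maps to as many [delta x] as it makes crossings from index
    [r] to index [0]. *)
Definition iota_fun (x : C) : functor (cyc r) C.
Proof.
refine (@Functor (cyc r) C (fun=> x) (fun i j n => dpow x ((i + sval n) %/ r.+1)) _ _).
- by move=> i; rewrite /= addn0 divn_small.
- move=> i j k m n; rewrite -dpowD; congr dpow.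
  have := svalP m; rewrite [in X in _ == X]modn_small // => /eqP ij.
  rewrite /= addnA {1}(divn_eq (i + sval m) r.+1) ij -addnA.
  by rewrite divnMDl.
Defined.

Definition iota_ob (x : C) : divided_ob C r.
Proof.
exists (iota_fun x) => i n nE /=.
by rewrite nE divnDr ?dvdnn // divnn divn_small // /dpow /= compm1.
Defined.

Definition iota_hom (x y : C) (f : hom x y) : divided_hom (iota_ob x) (iota_ob y).
Proof. by exists (fun=> f) => i j n /=; rewrite dpow_central. Defined.

Definition iota : functor C (divided C r).
Proof.
refine (@Functor C (divided C r) iota_ob iota_hom _ _).
- by move=> x; apply: divided_hom_ext.
- by move=> x y z f g; apply: divided_hom_ext.
Defined.

Definition eval0 : functor (divided C r) C.
Proof.
exact: (@Functor (divided C r) C (fun F : divided_ob C r => F ord0)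
  (fun F G (f : divided_hom F G) => f ord0) (fun=> erefl) (fun _ _ _ _ _ => erefl)).
Defined.

Lemma from0_proof (i : cyc r) : @ord0 r + i == i %[mod r.+1].
Proof. by []. Qed.

Definition from0 (i : cyc r) : hom (ord0 : cyc r) i := Steps (from0_proof i).

(** In terms of sequences, [u_0 <= u_i] for [i <= r]. *)
Definition tau (F : divided C r) : hom (iota (eval0 F)) F.
Proof.
exists (fun i => fmap F (from0 i)) => i j n.
pose d := (i + sval n) %/ r.+1.
have turns : @ord0 r + d * r.+1 == @ord0 r %[mod r.+1] by rewrite modnMl.
apply: etrans (fmapM F (from0 i) n).
rewrite (_ : from0 i \; n = Steps turns \; from0 j).
  by rewrite fmapM (@div_pow C r F _ (Steps turns) d erefl).
apply: steps_inj => /=.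
have := svalP n; rewrite [in X in _ == X]modn_small // => /eqP jE.
exact: etrans (divn_eq (i + sval n) r.+1) (congr1 (addn _) jE).
Defined.

Lemma iota_equivalence : is_equivalence (loc_map iota).
Proof.
apply: (@loc_equivalence _ _ iota eval0 (fun x => idm x) tau).
- by move=> x y f; rewrite comp1m compm1.
- by move=> F G f; apply: divided_hom_ext => i /=; rewrite div_natural.
Qed.

(** An object that is equal to its shift: all the factors of [delta y] are the
    same root [h], and the Garside element is [h] everywhere. *)
Section Roots.
Variables (y : C) (h : hom y y).
Hypothesis h_root : loop_pow h r.+1 = delta y.

Definition root_fun : functor (cyc r) C.
Proof.
refine (@Functor (cyc r) C (fun=> y) (fun i j n => loop_pow h (sval n)) _ _) => //.
by move=> i j k m n; apply: loop_powD.
Defined.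

Definition root_ob : divided C r.
Proof. by exists root_fun => i n /= ->. Defined.

Definition root_hom : hom root_ob root_ob.
Proof.
exists (fun=> h) => i j n /=; exact/esym/loop_pow_comm.
Defined.

Lemma root_hom_Delta : Arrow root_hom = Arrow (Delta_div root_ob).
Proof.
by apply: divided_arrow_ext => // i; rewrite /= compm1.
Qed.

End Roots.
End Iota.

(** The conjugating morphism [c] has components [v \; h^i]. It is natural from
    the one-factor factorization at [x] to the factorization of [delta y] into
    copies of [h], being composed of [v] and [tau]. *)
Lemma periodic_central (C : central_garside) (r : nat) (x : C)
    (gamma : @hom (localization C) x x) :
    loop_pow gamma r.+1 = fmap (loc_functor C) (delta x) ->
  exists (S' : garside_structure)
         (Theta : functor (localization C) (garside_groupoid S')),
    is_equivalence Theta /\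
    exists (y : S') (c : hom (Theta x) (to_groupoid S' y)),
      Arrow (fmap Theta gamma \; c) = Arrow (c \; fmap (to_groupoid S') (Delta y)).
Proof.
move=> gamma_periodic; have [m [g gE]] := loc_fraction gamma.
have g_periodic : loop_pow g r.+1 = dpow x (m * r.+1).+1.
  apply: loc_faithful; rewrite fmap_loop_pow -gE loop_pow_mul; last first.
    by rewrite loc_delta_central.
  rewrite gamma_periodic -fmap_loop_pow -fmapM delta_central -loop_powM.
  by rewrite mulnC.
have [y [v [h [gv h_root]]]] := periodic_loop_positive g_periodic.
pose Y := root_ob h_root.
pose c : hom (iota C r x) Y := fmap (iota C r) v \; tau Y.
have gc : fmap (iota C r) g \; c = fmap (iota C r) (dpow x m) \; (c \; root_hom h_root).
  apply: divided_hom_ext => i /=; rewrite compmA gv -!compmA; congr (_ \; (_ \; _)).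
  exact: loop_pow_comm.
exists (divided_garside C r), (loc_map (iota C r)); split; first exact: iota_equivalence.
exists Y, (fmap (loc_functor (divided C r)) c).
rewrite -[RHS](_ : Arrow (fmap (loc_functor (divided C r)) c \;
   fmap (loc_functor (divided C r)) (root_hom h_root)) = _); last first.
  by apply: arrow_comp => //; apply: arrow_fmap; apply: root_hom_Delta.
congr Arrow.
apply: (@iso_injl _ _ _ _ (fmap (loc_map (iota C r)) (fmap (loc_functor C) (dpow x m)))).
  exact: localization_groupoid.
rewrite compmA -fmapM gE !loc_mapE -!fmapM.
exact: (fmap_square (loc_functor (divided C r)) gc).
Qed.

(** * Reduction to a central Garside structure *)

Lemma retarget (C : category) (x y z : C) (f : hom x y) :
  y = z -> exists g : hom x z, Arrow g = Arrow f.
Proof. by move=> yz; subst z; exists f. Qed.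

Lemma functor_powD (C : category) (F : functor C C) m n :
  functor_eq (functor_pow F (m + n)) (functor_comp (functor_pow F m) (functor_pow F n)).
Proof. by elim: m => [|m IHm] //= x y f; rewrite [LHS]IHm. Qed.

Lemma functor_pow_period (C : category) (F : functor C C) k m :
  functor_eq (functor_pow F k) (functor_id C) ->
  functor_eq (functor_pow F (m * k)) (functor_id C).
Proof.
move=> Fk; elim: m => [|m IHm] // x y f.
rewrite mulSn functor_powD -[RHS]Fk; exact: IHm.
Qed.

Section Powers.
Variable S : garside_structure.

Lemma Delta_pow_natural n (x y : S) (f : hom x y) :
  f \; Delta_pow n y = Delta_pow n x \; fmap (functor_pow (phi S) n) f.
Proof.
elim: n => [|n IHn] in x y f *; first by rewrite /= comp1m compm1.
by rewrite /= compmA Delta_natural -!compmA IHn.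
Qed.

Lemma Delta_powD m n (x : S) :
  Arrow (Delta_pow (m + n) x) =
  Arrow (Delta_pow m x \; Delta_pow n (functor_pow (phi S) m x)).
Proof.
elim: m => [|m IHm] in x *; first by rewrite /= comp1m.
by rewrite /= -compmA; apply: arrow_comp => //; apply: IHm.
Qed.

Lemma Delta_pow_loop k p (x : S) (d : hom x x) :
  Arrow d = Arrow (Delta_pow p x) -> Arrow (loop_pow d k) = Arrow (Delta_pow (k * p) x).
Proof.
move=> dE; have /= xE := congr1 (@target S) dE.
elim: k => [|k IHk] //=; rewrite mulSn Delta_powD.
by apply: arrow_comp => //; rewrite IHk -xE.
Qed.

(** [Delta_pow N] is natural from the identity to [phi^N = 1], hence central; it
    starts with one [Delta], which the atoms divide. *)
Lemma central_power N :
    0 < N -> functor_eq (functor_pow (phi S) N) (functor_id S) ->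
  exists d : forall x : S, hom x x,
    [/\ forall x, Arrow (d x) = Arrow (Delta_pow N x),
        forall (x y : S) (f : hom x y), f \; d y = d x \; f &
        forall (x y : S) (f : hom x y), is_atom f -> exists g, f \; g = d x].
Proof.
move=> N_gt0 phiN.
have obN (x : S) : functor_pow (phi S) N x = x.
  exact: (congr1 (@source S) (phiN x x (idm x))).
have /dep_choice[d dE] := fun x => retarget (Delta_pow N x) (obN x).
exists d; split=> // x y f.
  apply: arrow_inj; rewrite (arrow_comp erefl (dE y)) Delta_pow_natural.
  by apply: arrow_comp; [rewrite dE | rewrite phiN].
move=> /atom_simple[fbar e]; case: N N_gt0 => // N _ in phiN obN dE *.
have [g gE] := retarget (fbar \; Delta_pow N (phi S x)) (obN x).
exists g; apply: arrow_inj; rewrite (arrow_comp erefl gE) dE /=.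
by rewrite compmA e.
Qed.

End Powers.

Theorem theorem0p5 (S : garside_structure) (S_cyclic : is_cyclic S)
    (x : garside_groupoid S) (gamma : hom x x) (p q : nat)
    (p_gt0 : 0 < p) (q_gt0 : 0 < q)
    (gamma_periodic :
      Arrow (loop_pow gamma q) = Arrow (fmap (to_groupoid S) (Delta_pow p x))) :
  exists (S' : garside_structure)
         (Theta : functor (garside_groupoid S) (garside_groupoid S')),
    is_equivalence Theta /\
    exists (y : S') (c : hom (Theta x) (to_groupoid S' y)),
      Arrow (fmap Theta gamma \; c) =
      Arrow (c \; fmap (to_groupoid S') (Delta y)).
Proof.
have [k k_gt0 phik] := S_cyclic.
have [d [dE d_central d_atom]] : exists d : forall x : S, hom x x,
    [/\ forall x, Arrow (d x) = Arrow (Delta_pow (k * p) x),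
        forall (x y : S) (f : hom x y), f \; d y = d x \; f &
        forall (x y : S) (f : hom x y), is_atom f -> exists g, f \; g = d x].
  apply: central_power; first by rewrite muln_gt0 k_gt0.
  by rewrite mulnC; apply: functor_pow_period.
have [l lP] := garside_homogeneous S.
pose C := @CentralGarside S d l d_central lP (@garside_cancellative S) d_atom
  (@lattice_from S).
apply: (@periodic_central C (k * q).-1 x gamma).
rewrite prednK ?muln_gt0 ?k_gt0 // loop_powM.
have [e eE] : exists e : @hom S x x, Arrow e = Arrow (Delta_pow p x).
  by apply: retarget; apply/esym; apply: (congr1 (@target _) gamma_periodic).
rewrite (_ : loop_pow gamma q = fmap (loc_functor S) e).
  apply: etrans (esym (fmap_loop_pow (loc_functor S) e k)) _.
  rewrite (_ : loop_pow e k = d x) //; apply: arrow_inj.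
  by rewrite (Delta_pow_loop k eE) dE.
apply: arrow_inj; apply: (etrans gamma_periodic); apply/esym.
exact: (arrow_fmap (loc_functor S) eE).
Qed.
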